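(* Let $\tau,\sigma\in\mathbb{C}$ with $\operatorname{Im}\tau>0$ and $\operatorname{Im}\sigma>0$. For any natural number $n\ge 1$ we have, as an identity of meromorphic functions of $z\in\mathbb{C}$, \[ \Gamma(nz,\tau,\sigma)\ =\ \prod_{k_1=0}^{n-1}\ \prod_{k_2=0}^{n-1}\ \prod_{k_3=0}^{n-1}\ \Gamma\Big(z+\frac{k_1+k_2\tau+k_3\sigma}{n},\ \tau,\ \sigma\Big). \]
   Context: For $z,\tau,\sigma\in\mathbb{C}$ with $\operatorname{Im}\tau>0$ and $\operatorname{Im}\sigma>0$, the elliptic gamma function (not the Euler gamma function) is the meromorphic function defined by the convergent infinite product \[ \Gamma(z,\tau,\sigma)=\prod_{j,k=0}^{\infty}\frac{1-e^{2\pi i((j+1)\tau+(k+1)\sigma-z)}}{1-e^{2\pi i(j\tau+k\sigma+z)}}. \] *)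

(* Defs.v *)
From HB Require Import structures.
From mathcomp Require Import all_boot all_order all_algebra.
From mathcomp Require Import complex.
From mathcomp Require Import all_classical all_reals all_analysis.

Set Implicit Arguments.
Unset Strict Implicit.
Unset Printing Implicit Defensive.

Import Order.TTheory GRing.Theory Num.Theory numFieldNormedType.Exports.
Local Open Scope ring_scope.
Local Open Scope complex_scope.
Local Open Scope classical_set_scope.

(* e^(x + iy) = e^x (cos y + i sin y) *)
Definition expC (R : realType) (z : R[i]) : R[i] :=
  (expR (complex.Re z))%:C * (cos (complex.Im z) +i* sin (complex.Im z)).

Definition e2pii (R : realType) (w : R[i]) : R[i] :=
  expC ((0 +i* (2%:R * pi)) * w).

Definition ellGamma_num (R : realType) (z tau sigma : R[i]) (j k : nat) : R[i] :=
  1 - e2pii (j.+1%:R * tau + k.+1%:R * sigma - z).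

Definition ellGamma_den (R : realType) (z tau sigma : R[i]) (j k : nat) : R[i] :=
  1 - e2pii (j%:R * tau + k%:R * sigma + z).

(* Rectangular partial products. The complex numbers carry their norm topology
   through the regular module R[i]^o. *)
Definition ellGamma_partial (R : realType) (z tau sigma : R[i]) (N : nat * nat) :
    R[i]^o :=
  \prod_(j < N.1) \prod_(k < N.2)
    (ellGamma_num z tau sigma j k / ellGamma_den z tau sigma j k).

(* The double product over j, k >= 0 is the limit of its partial products as
   the two bounds tend to infinity independently. It carries its intended
   meaning when z is not a pole: division by 0 yields 0. *)
Definition ellGamma (R : realType) (z tau sigma : R[i]) : R[i] :=
  lim (ellGamma_partial z tau sigma N @[N --> (\oo, \oo)]).

Definition ellGamma_pole (R : realType) (z tau sigma : R[i]) : Prop :=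
  exists j k : nat, ellGamma_den z tau sigma j k = 0.

(* Main.v *)
Require Import Defs.
From HB Require Import structures.
From mathcomp Require Import all_boot all_order all_algebra.
From mathcomp Require Import complex.
From mathcomp Require Import all_classical all_reals all_analysis.
From mathcomp Require Import ring lra.

Set Implicit Arguments.
Unset Strict Implicit.
Unset Printing Implicit Defensive.

Import Order.TTheory GRing.Theory Num.Theory numFieldNormedType.Exports.
Local Open Scope ring_scope.
Local Open Scope complex_scope.

(** The identity already holds, with no limit involved, between partial
products.  The n ^ 2 values of (k2, k3) split the indices below N1 * n and
N2 * n into residue classes modulo n, and for fixed (k2, k3) the product over
k1 runs over the n-th roots of unity, where
   (1 - x) (1 - w x) ... (1 - w ^ (n-1) x) = 1 - x ^ n
collapses n factors at z + (k1 + k2 tau + k3 sigma) / n into one factor at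
n z.  In the denominators (k2, k3) selects the residues k2 and k3; in the
numerators z enters with a minus sign, and the residues are n - 1 - k2 and
n - 1 - k3.  Hence the (N1 n, N2 n) partial product at n z is the product of
the (N1, N2) partial products at the shifted points [ellGamma_partial_mul].

It remains to let N1 and N2 tend to infinity, which requires every
partial product to converge [ellGamma_cvg].  With r = |e(tau)| < 1 and
s = |e(sigma)| < 1, where e(w) = exp(2 pi i w), each factor differs from 1 by
at most c r^j s^k: away from the poles the denominators are bounded below,
being close to 1 for all but finitely many (j, k)
[ellGamma_den_inv_bounded].  A double product of factors 1 + u j k with |u|
dominated by a summable v is Cauchy because its increments are dominated by
those of the bounded monotone product of the 1 + v j k [cvg_double_prod].  A
pole of a shifted factor would be a pole at n z [not_pole_shift], so the
hypothesis at n z covers all the factors. *)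

(** * The exponential exp (2 pi i w) and the roots of unity *)

Lemma e2piiE (R : realType) (w : R[i]) :
  e2pii w = (expR (- (2 * pi * complex.Im w)))%:C *
    (cos (2 * pi * complex.Re w) +i* sin (2 * pi * complex.Re w)).
Proof.
case: w => x y; rewrite /e2pii /expC /=.
by rewrite !mul0r !add0r.
Qed.

Lemma e2piiD (R : realType) (v w : R[i]) : e2pii (v + w) = e2pii v * e2pii w.
Proof.
rewrite !e2piiE !raddfD /= !mulrDr opprD expRD cosD sinD.
by apply/eqP; rewrite eq_complex /=; apply/andP; split; apply/eqP; ring.
Qed.

Lemma e2pii0 (R : realType) : e2pii 0 = 1 :> R[i].
Proof.
by rewrite e2piiE /= !mulr0 oppr0 expR0 cos0 sin0 mul1r.
Qed.

Lemma e2pii1 (R : realType) : e2pii 1 = 1 :> R[i].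
Proof.
by rewrite e2piiE /= mulr0 oppr0 expR0 mulr1 mulr_natl cos2pi sin2pi mul1r.
Qed.

Lemma e2pii_neq0 (R : realType) (w : R[i]) : e2pii w != 0.
Proof.
apply/eqP => w0; have := @e2piiD R w (- w).
by rewrite subrr e2pii0 w0 mul0r => /eqP; rewrite oner_eq0.
Qed.

Lemma e2piiN (R : realType) (w : R[i]) : e2pii (- w) = (e2pii w)^-1.
Proof.
apply: (mulfI (e2pii_neq0 w)); rewrite -e2piiD subrr e2pii0.
by rewrite divff ?e2pii_neq0.
Qed.

Lemma e2piiMn (R : realType) (w : R[i]) n : e2pii (n%:R * w) = e2pii w ^+ n.
Proof.
elim: n => [|n IHn]; first by rewrite mul0r e2pii0 expr0.
by rewrite -natr1 mulrDl mul1r e2piiD IHn exprSr.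
Qed.

Lemma norm_e2pii (R : realType) (w : R[i]) :
  `|e2pii w| = (expR (- (2 * pi * complex.Im w)))%:C.
Proof.
rewrite e2piiE normrM [X in _ * X]normc_def /= cos2Dsin2 sqrtr1 mulr1.
by rewrite ger0_norm // ler0c expR_ge0.
Qed.

(** For 0 < m < n the real part of exp (2 pi i m / n) is
1 - 2 sin^2 (pi m / n), which is below 1 since 0 < pi m / n < pi. *)
Lemma e2pii_natV_prim (R : realType) n : (0 < n)%N ->
  n.-primitive_root (e2pii (n%:R^-1 : R[i])).
Proof.
move=> n_gt0; have n_neq0 : n%:R != 0 :> R[i] by rewrite pnatr_eq0 -lt0n.
apply/andP; split=> //; apply/forallP => i; apply/eqP.
have [->|/eqP i_n] := i.+1 =P n.
  by apply/unity_rootP; rewrite -e2piiMn divff // e2pii1.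
apply/negP => /unity_rootP.
rewrite -e2piiMn e2piiE.
have -> : i.+1%:R / n%:R = (i.+1%:R / n%:R : R)%:C.
  by rewrite rmorphM fmorphV !rmorph_nat.
rewrite /= mulr0 oppr0 expR0 mul1r => /(congr1 (@complex.Re R)) /=.
set a := _ / _.
have a01 : 0 < a < 1.
  rewrite divr_gt0 ?ltr0n //= ltr_pdivrMr ?ltr0n // mul1r ltr_nat.
  by rewrite ltn_neqAle i_n ltn_ord.
have sa : 0 < sin (pi * a).
  have := @pi_gt0 R; move=> pi0; apply: sin_gt0_pi; apply/andP; split; nra.
have -> : 2 * pi * a = (pi * a) *+ 2 by rewrite mulr2n; ring.
rewrite cos_mulr2n cos2sin2 mulr2n; nra.
Qed.

(** This is the factorization of X^n - 1 evaluated at 1 / x and multiplied by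
x^n. *)
Lemma prod_prim_root (F : fieldType) n (w x : F) : n.-primitive_root w ->
  \prod_(0 <= k < n) (1 - w ^+ k * x) = 1 - x ^+ n.
Proof.
move=> wP; have n_gt0 := prim_order_gt0 wP.
have [->|x0] := eqVneq x 0.
  by rewrite expr0n gtn_eqF // big1 ?subr0 // => k _; rewrite mulr0 subr0.
have /(congr1 (fun p => x ^+ n * p.[x^-1])) := factor_Xn_sub_1 wP.
rewrite hornerD hornerN hornerXn -polyC1 hornerC mulrBr mulr1 exprVn.
rewrite divff ?expf_neq0 // => <-.
have -> : x ^+ n = \prod_(0 <= k < n) x by rewrite prodr_const_nat subn0.
rewrite horner_prod -big_split /=.
by apply: eq_bigr => k _; rewrite !hornerE mulrBr divff // mulrC.
Qed.

Section Torsion.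
Variables (R : realType) (n : nat).
Hypothesis n_gt0 : (0 < n)%N.

Lemma prod_e2pii_add (w : R[i]) :
  \prod_(0 <= k < n) (1 - e2pii (w + k%:R / n%:R)) = 1 - e2pii (n%:R * w).
Proof.
rewrite e2piiMn -(prod_prim_root _ (e2pii_natV_prim R n_gt0)).
by apply: eq_bigr => k _; rewrite e2piiD e2piiMn mulrC.
Qed.

(** The inverse of a primitive root of unity is again one. *)
Lemma prod_e2pii_sub (w : R[i]) :
  \prod_(0 <= k < n) (1 - e2pii (w - k%:R / n%:R)) = 1 - e2pii (n%:R * w).
Proof.
have wP : n.-primitive_root (e2pii (n%:R^-1 : R[i]))^-1.
  have /andP[_ /forallP wP] := e2pii_natV_prim R n_gt0.
  apply/andP; split=> //; apply/forallP => i; rewrite -(eqP (wP i)).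
  by rewrite !unity_rootE exprVn invr_eq1.
rewrite e2piiMn -(prod_prim_root _ wP).
by apply: eq_bigr => k _; rewrite e2piiD e2piiN e2piiMn exprVn mulrC.
Qed.

End Torsion.

(** * The identity between partial products *)

(** Euclidean division by n enumerates the indices below N * n as j * n + r. *)
Lemma prod_residues (T : comNzRingType) n N (F : nat -> T) :
  \prod_(0 <= r < n) \prod_(0 <= j < N) F (j * n + r)%N =
  \prod_(0 <= j < N * n) F j.
Proof.
rewrite exchange_big big_nat_mul /=; apply: eq_bigr => j _.
rewrite -{2}[(j * n)%N]add0n big_addn mulSn addnK.
by apply: eq_bigr => r _; rewrite addnC.
Qed.

Lemma prod_residues_rev (T : comNzRingType) n N (F : nat -> T) :
  \prod_(0 <= r < n) \prod_(0 <= j < N) F (j * n + (n - r.+1))%N =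
  \prod_(0 <= j < N * n) F j.
Proof.
by rewrite -prod_residues [RHS]big_nat_rev.
Qed.

Section FiniteIdentity.
Variables (R : realType) (tau sigma : R[i]) (n : nat).
Hypothesis n_gt0 : (0 < n)%N.

Let n_neq0 : n%:R != 0 :> R[i].
Proof. by rewrite pnatr_eq0 -lt0n. Qed.

Definition torsion_shift (z : R[i]) k1 k2 k3 : R[i] :=
  z + (k1%:R + k2%:R * tau + k3%:R * sigma) / n%:R.

Lemma prod_den_shift z k2 k3 j k :
  \prod_(0 <= k1 < n) ellGamma_den (torsion_shift z k1 k2 k3) tau sigma j k =
  ellGamma_den (n%:R * z) tau sigma (j * n + k2) (k * n + k3).
Proof.
rewrite /ellGamma_den.
transitivity (1 - e2pii (n%:R * (j%:R * tau + k%:R * sigma +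
    (z + (k2%:R * tau + k3%:R * sigma) / n%:R)))).
  rewrite -(prod_e2pii_add n_gt0); apply: eq_bigr => k1 _.
  by congr (1 - e2pii _); rewrite /torsion_shift; ring.
by congr (1 - e2pii _); rewrite !natrD !natrM; field.
Qed.

(** Multiplying j.+1 * tau - k2 * tau / n by n gives the coefficient
j * n + n - k2, and the successor in the numerator leaves the index
j * n + (n - k2.+1); this is where k2 < n matters. *)
Lemma prod_num_shift z k2 k3 j k : (k2 < n)%N -> (k3 < n)%N ->
  \prod_(0 <= k1 < n) ellGamma_num (torsion_shift z k1 k2 k3) tau sigma j k =
  ellGamma_num (n%:R * z) tau sigma (j * n + (n - k2.+1)) (k * n + (n - k3.+1)).
Proof.
move=> k2n k3n; rewrite /ellGamma_num.
transitivity (1 - e2pii (n%:R * (j.+1%:R * tau + k.+1%:R * sigma -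
    (z + (k2%:R * tau + k3%:R * sigma) / n%:R)))).
  rewrite -(prod_e2pii_sub n_gt0); apply: eq_bigr => k1 _.
  by congr (1 - e2pii _); rewrite /torsion_shift; ring.
rewrite -!addnS -!subSn // !subSS; congr (1 - e2pii _).
by rewrite !natrD !natrM !natrB 1?ltnW // -!natr1; field.
Qed.

Lemma ellGamma_partialE z N1 N2 :
  ellGamma_partial z tau sigma (N1, N2) =
  (\prod_(0 <= j < N1) \prod_(0 <= k < N2) ellGamma_num z tau sigma j k) /
  (\prod_(0 <= j < N1) \prod_(0 <= k < N2) ellGamma_den z tau sigma j k).
Proof.
rewrite /ellGamma_partial big_mkord [X in _ / X]big_mkord -prodf_div.
by apply: eq_bigr => j _; rewrite !big_mkord -prodf_div.
Qed.

Let prod_swap (F : nat -> nat -> nat -> nat -> nat -> R[i]) N1 N2 :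
  \prod_(0 <= k1 < n) \prod_(0 <= k2 < n) \prod_(0 <= k3 < n)
    \prod_(0 <= j < N1) \prod_(0 <= k < N2) F k1 k2 k3 j k =
  \prod_(0 <= k2 < n) \prod_(0 <= j < N1) \prod_(0 <= k3 < n)
    \prod_(0 <= k < N2) \prod_(0 <= k1 < n) F k1 k2 k3 j k.
Proof.
rewrite exchange_big; apply: eq_bigr => k2 _.
rewrite exchange_big [RHS]exchange_big; apply: eq_bigr => k3 _.
rewrite exchange_big; apply: eq_bigr => j _.
by rewrite exchange_big.
Qed.

(** Numerators and denominators are regrouped separately, since a given shift
selects different residue classes in each of them.  The quotients split this
way at poles as well, because inversion is multiplicative with 0^-1 = 0. *)
Lemma ellGamma_partial_mul z N1 N2 :
  ellGamma_partial (n%:R * z) tau sigma ((N1 * n)%N, (N2 * n)%N) =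
  \prod_(0 <= k1 < n) \prod_(0 <= k2 < n) \prod_(0 <= k3 < n)
    ellGamma_partial (torsion_shift z k1 k2 k3) tau sigma (N1, N2).
Proof.
under [RHS]eq_bigr => k1 _ do under eq_bigr => k2 _ do
  under eq_bigr => k3 _ do rewrite ellGamma_partialE.
under [RHS]eq_bigr => k1 _ do under eq_bigr => k2 _ do rewrite prodf_div.
under [RHS]eq_bigr => k1 _ do rewrite prodf_div.
rewrite prodf_div ellGamma_partialE !prod_swap; congr (_ / _).
  rewrite -prod_residues_rev; apply: eq_big_nat => k2 /andP[_ k2n].
  apply: eq_bigr => j _.
  rewrite -prod_residues_rev; apply: eq_big_nat => k3 /andP[_ k3n].
  by apply: eq_bigr => k _; rewrite prod_num_shift.
rewrite -prod_residues; apply: eq_bigr => k2 _; apply: eq_bigr => j _.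
rewrite -prod_residues; apply: eq_bigr => k3 _.
by apply: eq_bigr => k _; rewrite prod_den_shift.
Qed.

(** A vanishing denominator at a shifted point is one of the factors of a
denominator at n z. *)
Lemma not_pole_shift z k1 k2 k3 : (k1 < n)%N ->
  ~ ellGamma_pole (n%:R * z) tau sigma ->
  ~ ellGamma_pole (torsion_shift z k1 k2 k3) tau sigma.
Proof.
move=> k1n npole [j [k den0]]; apply: npole.
exists (j * n + k2)%N, (k * n + k3)%N; rewrite -prod_den_shift.
apply/eqP; rewrite prodf_seq_eq0; apply/hasP.
exists k1; first by rewrite mem_index_iota.
by rewrite /= den0.
Qed.

End FiniteIdentity.

(** * Dominated products *)

Lemma norm_prod_le (I : Type) (T : numDomainType) (s : seq I) (A : pred I)
    (u v : I -> T) : (forall i, `|u i| <= v i) ->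
  `|\prod_(i <- s | A i) (1 + u i)| <= \prod_(i <- s | A i) (1 + v i).
Proof.
move=> uv; rewrite normr_prod; apply: ler_prod => i _.
by rewrite normr_ge0 (le_trans (ler_normD _ _)) // normr1 lerD2l.
Qed.

(** Expanding both products, the left-hand side is a sum of monomials in the
u i, each of which is dominated by the same monomial in the v i, and the
latter monomials add up to the right-hand side. *)
Lemma norm_prod_sub_le (I : Type) (T : numDomainType) (s : seq I) (A : pred I)
    (u v : I -> T) : (forall i, `|u i| <= v i) ->
  `|\prod_(i <- s) (1 + u i) - \prod_(i <- s | A i) (1 + u i)| <=
  \prod_(i <- s) (1 + v i) - \prod_(i <- s | A i) (1 + v i).
Proof.
move=> uv; have v0 i : 0 <= v i by apply: le_trans (uv i).
elim: s => [|i s IHs]; first by rewrite !big_nil !subrr normr0.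
rewrite !big_cons; case: (A i).
  rewrite -!mulrBr normrM ler_pM // (le_trans (ler_normD _ _)) //.
  by rewrite normr1 lerD2l.
rewrite !mulrDl !mul1r addrAC [leRHS]addrAC (le_trans (ler_normD _ _)) //.
by rewrite lerD // normrM ler_pM // (@norm_prod_le _ _ s predT).
Qed.

(** * Completeness of the complex numbers *)

Lemma normc_ge_Im (R : rcfType) (w : R[i]) : `|complex.Im w|%:C <= `|w|.
Proof.
rewrite normc_def lecR -sqrtr_sqr.
by rewrite ler_wsqrtr // lerDr sqr_ge0.
Qed.

Lemma normc_le_ReIm (R : rcfType) (w : R[i]) :
  `|w| <= (`|complex.Re w| + `|complex.Im w|)%:C.
Proof.
rewrite normc_def lecR -[leRHS]ger0_norm ?addr_ge0 // -[leRHS]sqrtr_sqr.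
rewrite ler_wsqrtr //.
by rewrite sqrrD !real_normK ?num_real // addrAC lerDl mulrn_wge0 ?mulr_ge0.
Qed.

Section Convergence.
Local Open Scope classical_set_scope.

(** The real and imaginary parts are Cauchy in R, which is complete. *)
Lemma complex_cauchy_cvg (R : realType) (T : Type) (F : set_system T)
    {FF : ProperFilter F} (f : T -> R[i]^o) :
  (forall e : R, 0 < e ->
    exists c : R[i], \forall t \near F, `|f t - c| < e%:C) ->
  exists l : R[i]^o, f t @[t --> F] --> l.
Proof.
move=> fcauchy.
have part (p : {additive R[i] -> R}) : (forall x : R[i], `|p x|%:C <= `|x|) ->
    exists l : R, p (f t) @[t --> F] --> l.
  move=> ple; apply/cvg_ex/cauchy_cvgP/cauchy_exP => e e0.
  have [c fc] := fcauchy e e0; exists (p c).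
  apply: filterS fc => t fct; rewrite /ball /= -ltcR distrC -raddfB.
  exact: le_lt_trans (ple _) fct.
have [x fx] := part (@complex.Re R) (@normc_ge_Re R).
have [y fy] := part (@complex.Im R) (@normc_ge_Im R).
exists (x +i* y); apply/cvgrPdist_lt => e e0.
have eE : e = (complex.Re e)%:C by rewrite RRe_real // gtr0_real.
have e2 : 0 < complex.Re e / 2 by rewrite divr_gt0 // -ltcR -eE.
have /cvgrPdist_lt/(_ _ e2) fxe := fx.
have /cvgrPdist_lt/(_ _ e2) fye := fy.
near=> t.
have ft : `|x - complex.Re (f t)| < complex.Re e / 2 by near: t.
have gt : `|y - complex.Im (f t)| < complex.Re e / 2 by near: t.
apply: le_lt_trans (normc_le_ReIm _) _.
by rewrite eE ltcR !raddfB /=; lra.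
Unshelve. all: end_near. Qed.

(** * Convergence of dominated double products *)

(** Listing the index pairs turns a double product into a single one, to which
[norm_prod_sub_le] applies. *)
Definition rectangle (N : nat * nat) : seq (nat * nat) :=
  [seq (j, k) | j <- index_iota 0 N.1, k <- index_iota 0 N.2].

Lemma prod_rectangle (T : comNzRingType) (F : nat -> nat -> T) (N : nat * nat) :
  \prod_(0 <= j < N.1) \prod_(0 <= k < N.2) F j k =
  \prod_(p <- rectangle N) F p.1 p.2.
Proof. by rewrite big_allpairs. Qed.

Lemma prod_subrectangle (T : comNzRingType) (F : nat -> nat -> T)
    (M N : nat * nat) : (M.1 <= N.1)%N -> (M.2 <= N.2)%N ->
  \prod_(0 <= j < M.1) \prod_(0 <= k < M.2) F j k =
  \prod_(p <- rectangle N | (p.1 < M.1)%N && (p.2 < M.2)%N) F p.1 p.2.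
Proof.
move=> MN1 MN2; rewrite (big_nat_widen _ _ _ _ _ MN1).
rewrite big_mkcond [RHS]big_mkcond big_allpairs /=; apply: eq_bigr => j _ /=.
case: (j < M.1)%N; last by rewrite big1.
by rewrite (big_nat_widen _ _ _ _ _ MN2) big_mkcond.
Qed.

Lemma prod_expR_le (R : realType) (v : nat -> nat -> R) N1 N2 :
  (forall j k, 0 <= v j k) ->
  \prod_(0 <= j < N1) \prod_(0 <= k < N2) (1 + v j k) <=
  expR (\sum_(0 <= j < N1) \sum_(0 <= k < N2) v j k).
Proof.
move=> v0; rewrite expR_sum; apply: ler_prod => j _.
rewrite prodr_ge0 /= => [|k _]; last by rewrite addr_ge0.
rewrite expR_sum; apply: ler_prod => k _.
by rewrite addr_ge0 //= expR_ge1Dx.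
Qed.

(** The products of the 1 + v j k increase with the rectangle and are at most
exp S, so they have a supremum.  Once such a product is within e of the
supremum, enlarging the rectangle changes it by less than e, hence by
[norm_prod_sub_le] also changes the product of the 1 + u j k by less than e. *)
Lemma cvg_double_prod (R : realType) (u : nat -> nat -> R[i])
    (v : nat -> nat -> R) (S : R) :
  (forall j k, `|u j k| <= (v j k)%:C) ->
  (forall N1 N2, \sum_(0 <= j < N1) \sum_(0 <= k < N2) v j k <= S) ->
  exists l : R[i]^o,
    (\prod_(j < N.1) \prod_(k < N.2) (1 + u j k) : R[i]^o)
      @[N --> (\oo, \oo)] --> l.
Proof.
move=> uv vS; have v0 j k : 0 <= v j k by rewrite -ler0c (le_trans _ (uv j k)).
pose Q N := \prod_(0 <= j < N.1) \prod_(0 <= k < N.2) (1 + v j k).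
have Q_sup : has_sup (range Q).
  split; first by exists (Q (0, 0)%N), (0, 0)%N.
  exists (expR S) => _ [N _ <-].
  by rewrite (le_trans (prod_expR_le _ _ v0)) // ler_expR.
apply: complex_cauchy_cvg => e e0.
have [_ [M _ <-] QM] := sup_adherent e0 Q_sup.
exists (\prod_(0 <= j < M.1) \prod_(0 <= k < M.2) (1 + u j k)).
exists ([set m | (M.1 <= m)%N], [set m | (M.2 <= m)%N]).
  by split=> /=; exact: nbhs_infty_ge.
case=> N1 N2 /= [MN1 MN2].
have QN : Q (N1, N2) - Q M < e.
  rewrite ltrBlDr -ltrBlDl (le_lt_trans _ QM) //.
  by rewrite lerB //; apply: (ub_le_sup Q_sup.2); exists (N1, N2).
rewrite -ltcR in QN; apply: le_lt_trans QN.
rewrite (eq_bigr (fun j : 'I_N1 => \prod_(0 <= k < N2) (1 + u j k))); last first.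
  by move=> j _; rewrite big_mkord.
rewrite -(big_mkord predT (fun j => \prod_(0 <= k < N2) (1 + u j k))).
rewrite /Q rmorphB !rmorph_prod /=.
under [X in _ <= X - _]eq_bigr do rewrite rmorph_prod.
under [X in _ <= _ - X]eq_bigr do rewrite rmorph_prod.
rewrite !(prod_rectangle _ (N1, N2)) !(@prod_subrectangle _ _ M (N1, N2)) //=.
under [X in _ <= X - _]eq_bigr do rewrite rmorphD rmorph1.
under [X in _ <= _ - X]eq_bigr do rewrite rmorphD rmorph1.
by apply: norm_prod_sub_le => p; exact: uv.
Qed.

Lemma cvg_mulnr2 n : (0 < n)%N ->
  ((N.1 * n)%N, (N.2 * n)%N) @[N --> (\oo, \oo)] --> (\oo, \oo).
Proof.
move=> n_gt0; apply: cvg_pair.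
  exact: cvg_comp cvg_fst (cvg_mulnr n n_gt0).
exact: cvg_comp cvg_snd (cvg_mulnr n n_gt0).
Qed.

(** * Convergence of the elliptic gamma product *)

Section Gamma.
Variables (R : realType) (tau sigma : R[i]).
Hypotheses (tau_gt0 : 0 < complex.Im tau) (sigma_gt0 : 0 < complex.Im sigma).

Let r : R := expR (- (2 * pi * complex.Im tau)).
Let s : R := expR (- (2 * pi * complex.Im sigma)).

Let r01 : 0 <= r < 1.
Proof. by rewrite expR_ge0 expR_lt1 oppr_lt0 !mulr_gt0 ?pi_gt0. Qed.

Let s01 : 0 <= s < 1.
Proof. by rewrite expR_ge0 expR_lt1 oppr_lt0 !mulr_gt0 ?pi_gt0. Qed.

Lemma norm_e2pii_lattice (z : R[i]) j k :
  `|e2pii (j%:R * tau + k%:R * sigma + z)| = (r ^+ j * s ^+ k)%:C * `|e2pii z|.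
Proof.
rewrite !e2piiD !e2piiMn !normrM !normrX !norm_e2pii -/r -/s.
by rewrite [in RHS]rmorphM !rmorphXn.
Qed.

Lemma expr_small (q c : R) : 0 <= q < 1 -> exists n, c * q ^+ n <= 2^-1.
Proof.
move=> /andP[q0 q1].
have : c * q ^+ n @[n --> \oo] --> c * 0.
  by apply: cvgM; [exact: cvg_cst|apply: cvg_expr; rewrite ger0_norm].
rewrite mulr0 => /cvgrPdist_le /(_ 2^-1).
case=> [|n _ /(_ n (leqnn n))]; first by rewrite invr_gt0.
by rewrite sub0r normrN => h; exists n; apply: le_trans h; rewrite ler_norm.
Qed.

(** Let X = |exp (2 pi i z)|.  If X r^J and X s^K are at most 1/2, then every
denominator with j >= J or k >= K has norm at least 1/2, and the remaining
inverses are finitely many, so adding up their norms bounds them all. *)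
Lemma ellGamma_den_inv_bounded (z : R[i]) : exists C : R, forall j k,
  `|(ellGamma_den z tau sigma j k)^-1| <= C%:C.
Proof.
pose X : R := complex.Re `|e2pii z|.
have XE : `|e2pii z| = X%:C by rewrite RRe_real ?normr_real.
have X0 : 0 <= X by rewrite -ler0c -XE.
have [/andP[r0 r1] /andP[s0 s1]] := (r01, s01).
have [J HJ] := expr_small X r01; have [K HK] := expr_small X s01.
pose D j k : R := complex.Re `|(ellGamma_den z tau sigma j k)^-1|.
have DE j k : `|(ellGamma_den z tau sigma j k)^-1| = (D j k)%:C.
  by rewrite RRe_real ?normr_real.
have D0 j k : 0 <= D j k by rewrite -ler0c -DE.
exists (2 + \sum_(p : 'I_J * 'I_K) D p.1 p.2) => j k.
have [|Hjk] := boolP ((j < J) && (k < K))%N.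
  case/andP=> jJ kK; rewrite DE lecR (bigD1 (Ordinal jJ, Ordinal kK)) //=.
  by rewrite addrCA lerDl addr_ge0 // sumr_ge0.
apply: (@le_trans _ _ 2%:C); last by rewrite lecR lerDl sumr_ge0.
have small : X * (r ^+ j * s ^+ k) <= 2^-1.
  move: Hjk; rewrite negb_and -!leqNgt => /orP[Jj|Kk].
    apply: le_trans HJ; rewrite ler_wpM2l //.
    rewrite -[leRHS]mulr1 ler_pM ?exprn_ge0 ?exprn_ile1 //; last exact: ltW.
    by rewrite ler_wiXn2l // ltW.
  apply: le_trans HK; rewrite ler_wpM2l //.
  rewrite -[leRHS]mul1r ler_pM ?exprn_ge0 ?exprn_ile1 //; first exact: ltW.
  by rewrite ler_wiXn2l // ltW.
have half : (2^-1)%:C <= `|ellGamma_den z tau sigma j k|.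
  rewrite (le_trans _ (lerB_dist _ _)) // normr1 norm_e2pii_lattice XE -rmorphM.
  by rewrite -(rmorph1 (@real_complex R)) -rmorphB lecR /=; lra.
have half0 : 0 < (2^-1 : R)%:C by rewrite (ltcR 0) invr_gt0.
rewrite normfV -[2]invrK fmorphV lef_pV2 // posrE //.
exact: lt_le_trans half0 half.
Qed.

Lemma sum_geometric2_le (c : R) N1 N2 : 0 <= c ->
  \sum_(0 <= j < N1) \sum_(0 <= k < N2) c * (r ^+ j * s ^+ k) <=
  c * ((1 - r)^-1 * (1 - s)^-1).
Proof.
move=> c0.
under eq_bigr do rewrite -mulr_sumr -mulr_sumr.
rewrite -mulr_sumr -mulr_suml ler_wpM2l //.
have geo (q : R) N : 0 <= q < 1 -> 0 <= \sum_(0 <= j < N) q ^+ j <= (1 - q)^-1.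
  case/andP=> q0 q1; rewrite sumr_ge0 /= => [|j _]; last exact: exprn_ge0.
  rewrite -[leRHS]mulr1 ler_pdivlMl ?subr_gt0 // big_mkord.
  by rewrite -opprB mulNr -subrX1 opprB gerBl exprn_ge0.
have [/andP[r1 r2] /andP[s1 s2]] := (geo r N1 r01, geo s N2 s01).
exact: ler_pM.
Qed.

(** The difference between numerator and denominator is
exp (2 pi i (j tau + k sigma)) times a quantity that does not depend on j and
k, so each factor is 1 + O(r^j s^k). *)
Lemma ellGamma_cvg (z : R[i]) : ~ ellGamma_pole z tau sigma ->
  ellGamma_partial z tau sigma N @[N --> (\oo, \oo)] -->
    (ellGamma z tau sigma : R[i]^o).
Proof.
move=> npole.
pose q j k := ellGamma_num z tau sigma j k / ellGamma_den z tau sigma j k.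
have [C HC] := ellGamma_den_inv_bounded z.
pose B := complex.Re (`|e2pii z| + `|e2pii (tau + sigma - z)|).
have BE : B%:C = `|e2pii z| + `|e2pii (tau + sigma - z)|.
  by rewrite RRe_real // rpredD ?normr_real.
have B0 : 0 <= B by rewrite -ler0c BE addr_ge0.
have C0 : 0 <= C by rewrite -ler0c (le_trans _ (HC 0 0)%N).
have qB j k : `|q j k - 1| <= (B * C * (r ^+ j * s ^+ k))%:C.
  have den0 : ellGamma_den z tau sigma j k != 0.
    by apply/eqP => den0; apply: npole; exists j, k.
  have -> : q j k - 1 = (e2pii (j%:R * tau + k%:R * sigma + z) -
      e2pii (j%:R * tau + k%:R * sigma + (tau + sigma - z))) *
      (ellGamma_den z tau sigma j k)^-1.
    rewrite -[X in _ - X](divff den0) -mulrBl; congr (_ * _).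
    rewrite /ellGamma_num /ellGamma_den opprD opprK addrACA subrr add0r addrC.
    by congr (_ - e2pii _); rewrite -!natr1; ring.
  rewrite normrM mulrAC [leRHS]rmorphM ler_pM //.
  apply: le_trans (ler_normB _ _) _.
  rewrite [X in X + _]norm_e2pii_lattice [X in _ + X]norm_e2pii_lattice.
  by rewrite -mulrDr -BE -rmorphM mulrC.
have [l] := cvg_double_prod qB
  (fun N1 N2 => sum_geometric2_le N1 N2 (mulr_ge0 B0 C0)).
have -> : (fun N : nat * nat => \prod_(j < N.1) \prod_(k < N.2) (1 + (q j k - 1)))
    = ellGamma_partial z tau sigma.
  by apply/funext => N; under eq_bigr do under eq_bigr do rewrite addrC subrK.
move=> cl; suff <- : l = ellGamma z tau sigma by [].
by apply/esym/cvg_lim => //; exact: norm_hausdorff.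
Qed.

End Gamma.

End Convergence.

Theorem mainTheorem1 (R : realType) (tau sigma : R[i])
    (tau_gt0 : 0 < complex.Im tau) (sigma_gt0 : 0 < complex.Im sigma)
    (n : nat) (n_ge1 : (1 <= n)%N) :
  forall z : R[i], ~ ellGamma_pole (n%:R * z) tau sigma ->
  ellGamma (n%:R * z) tau sigma =
  \prod_(0 <= k1 < n) \prod_(0 <= k2 < n) \prod_(0 <= k3 < n)
    ellGamma (z + (k1%:R + k2%:R * tau + k3%:R * sigma) / n%:R) tau sigma.
Proof.
move=> z npole.
(* The partial products at n z, along the cofinal family of rectangles with
   sides divisible by n. *)
have lhs := cvg_comp _ _ (cvg_mulnr2 n_ge1)
  (ellGamma_cvg tau_gt0 sigma_gt0 npole).
apply: (cvg_unique _ lhs); first exact: norm_hausdorff.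
(* The bound on k1 becomes part of the index predicate because
   [not_pole_shift] needs it below. *)
rewrite (_ : _ \o _ = fun N => \prod_(0 <= k1 < n | (0 <= k1 < n)%N)
    \prod_(0 <= k2 < n) \prod_(0 <= k3 < n)
      ellGamma_partial (torsion_shift tau sigma n z k1 k2 k3) tau sigma N);
  last first.
  by apply/funext => -[N1 N2] /=; rewrite ellGamma_partial_mul // big_nat.
rewrite big_nat.
apply: (@cvg_big R[i]^o) => [|k1 /andP[_ k1n]]; first exact: mul_continuous.
apply: (@cvg_big R[i]^o) => [|k2 _]; first exact: mul_continuous.
apply: (@cvg_big R[i]^o) => [|k3 _]; first exact: mul_continuous.
by apply: ellGamma_cvg => //; exact: not_pole_shift.
Qed.
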